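(* Let $p$ be a prime and let $G=D_{2p^2}$. Then $$E(\mathcal{B}(G))=2+2p^2\sqrt{3}+(2p+2)\sqrt{p^2-1}+4p\sqrt{3p(p-1)},$$ $$LE(\mathcal{B}(G))=\frac{32p^8+2p^4+4p^3+18p^2+16p+32}{4p^4+p^2+p+4}=LE^+(\mathcal{B}(G)),$$ and $$E_{CN}(\mathcal{B}(G))=8p^4-2p^2-2p-8.$$
   Context: $D_{2m}=\langle a,b : a^m=b^2=1,\ bab=a^{-1}\rangle$ is the dihedral group of order $2m$. For a finite group $G$, let $L(G)$ be the set of all subgroups of $G$. The subgroup generating bipartite graph $\mathcal{B}(G)$ is the simple bipartite graph with vertex set the disjoint union of $G\times G$ and $L(G)$, in which $(a,b)\in G\times G$ and $H\in L(G)$ are adjacent if and only if $H$ is the subgroup generated by $a$ and $b$ (and there are no other edges). For a finite simple graph $\Gamma$ with $n$ vertices $v_1,\dots,v_n$ and $m$ edges, let $A$ be its adjacency matrix, $D$ its diagonal degree matrix, and $CN(\Gamma)$ the common neighborhood matrix, whose $(i,j)$ entry for $i\neq j$ is the number of vertices other than $v_i,v_j$ adjacent to both $v_i$ and $v_j$, with zero diagonal. The energy $E(\Gamma)$ and the common neighborhood energy $E_{CN}(\Gamma)$ are the sums of absolute values of the eigenvalues (with multiplicity) of $A$ and $CN(\Gamma)$ respectively. The Laplacian energy is $LE(\Gamma)=\sum_{\lambda}|\lambda-\frac{2m}{n}|$ over the eigenvalues $\lambda$ of $D-A$, and the signless Laplacian energy is $LE^+(\Gamma)=\sum_{\mu}|\mu-\frac{2m}{n}|$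 over the eigenvalues $\mu$ of $D+A$ (both counted with multiplicity). *)

(* Defs.v *)
From HB Require Import structures.
From mathcomp Require Import all_boot all_order all_algebra all_fingroup.
From mathcomp Require Import all_solvable.

Set Implicit Arguments.
Unset Strict Implicit.
Unset Printing Implicit Defensive.

Import Order.TTheory GRing.Theory Num.Theory.

Record sgraph := SGraph {
  vertex :> finType;
  adj : rel vertex;
  adj_sym : symmetric adj;
  adj_irrefl : irreflexive adj
}.
Arguments adj {_} _ _.

Section GraphInvariants.
Variable Gamma : sgraph.
Implicit Types u v w : Gamma.

Definition degree v : nat := #|[set w | adj v w]|.

Definition edges : {set {set Gamma}} :=
  [set e | [exists u, exists v, adj u v && (e == [set u; v])]].

Definition num_vertices : nat := #|Gamma|.

Definition num_edges : nat := #|edges|.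

Definition common_neighbors u v : {set Gamma} :=
  [set w | [&& w != u, w != v, adj u w & adj v w]].

End GraphInvariants.

Local Open Scope ring_scope.

(* Matrices are indexed by 'I_#|Gamma|, the vertices being listed as
   enum_val 0, enum_val 1, etc. *)
Section GraphMatrices.
Variables (C : numClosedFieldType) (Gamma : sgraph).

Definition adjacency_mx : 'M[C]_#|Gamma| :=
  \matrix_(i, j) (adj (enum_val i : Gamma) (enum_val j))%:R.

Definition degree_mx : 'M[C]_#|Gamma| :=
  \matrix_(i, j) ((degree (enum_val i : Gamma))%:R *+ (i == j)).

Definition cn_mx : 'M[C]_#|Gamma| :=
  \matrix_(i, j)
    if i == j then 0
    else #|common_neighbors (enum_val i : Gamma) (enum_val j)|%:R.

Definition laplacian_mx : 'M[C]_#|Gamma| := degree_mx - adjacency_mx.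

Definition signless_laplacian_mx : 'M[C]_#|Gamma| := degree_mx + adjacency_mx.

End GraphMatrices.

(* The eigenvalues listed with algebraic multiplicity; for the (real symmetric)
   matrices above this is also the geometric multiplicity. *)
Definition spectrum (C : numClosedFieldType) n (A : 'M[C]_n) : seq C :=
  sval (closed_field_poly_normal (char_poly A)).

Lemma char_poly_spectrum (C : numClosedFieldType) n (A : 'M[C]_n) :
  char_poly A = \prod_(z <- spectrum A) ('X - z%:P).
Proof.
rewrite /spectrum; case: closed_field_poly_normal => s /= {1}->.
by rewrite (monicP (char_poly_monic A)) scale1r.
Qed.

Section Energies.
Variables (C : numClosedFieldType) (Gamma : sgraph).

Definition average_degree : C :=
  2 * (num_edges Gamma)%:R / (num_vertices Gamma)%:R.

Definition energy : C :=
  \sum_(z <- spectrum (adjacency_mx C Gamma)) `|z|.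

Definition cn_energy : C :=
  \sum_(z <- spectrum (cn_mx C Gamma)) `|z|.

Definition laplacian_energy : C :=
  \sum_(z <- spectrum (laplacian_mx C Gamma)) `|z - average_degree|.

Definition signless_laplacian_energy : C :=
  \sum_(z <- spectrum (signless_laplacian_mx C Gamma)) `|z - average_degree|.

End Energies.

Section SubgroupGeneratingBipartiteGraph.
Variables (gT : finGroupType) (G : {group gT}).

Definition sgb_vertex : finType :=
  ({x : gT * gT | x \in setX G G} + {H : {group gT} | H \in subgroups G})%type.

Definition sgb_adj (u v : sgb_vertex) : bool :=
  match u, v with
  | inl x, inr H | inr H, inl x =>
      val H :==: <<[set (val x).1; (val x).2]>>%g
  | _, _ => false
  end.

Lemma sgb_adj_sym : symmetric sgb_adj.
Proof. by case=> [x|H] [y|K]. Qed.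

Lemma sgb_adj_irrefl : irreflexive sgb_adj.
Proof. by case. Qed.

Definition sgb_graph : sgraph := SGraph sgb_adj_sym sgb_adj_irrefl.

End SubgroupGeneratingBipartiteGraph.

Definition is_dihedral (m : nat) (gT : finGroupType) (G : {group gT}) : Prop :=
  (G \isog Grp (a : b : a ^+ m, b ^+ 2, b * a * b = a^-1))%g.

Lemma is_dihedralE (m : nat) (gT : finGroupType) (G : {group gT}) :
  (1 < m)%N -> is_dihedral m G <-> (G \isog [set: 'D_(2 * m)])%g.
Proof.
move=> m_gt1.
have invol (rT : finGroupType) (b : rT) : (b ^+ 2 == 1)%g -> (b^-1 = b)%g.
  by move=> b2; apply/eqP; rewrite eq_invg_mul -expg2.
have relE rT (H : {group rT}) :
    (H \homg [set: 'D_(2 * m)])%g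
    = (H \homg Grp (a : b : a ^+ m, b ^+ 2, b * a * b = a^-1))%g.
  rewrite mul2n (Grp_dihedral m_gt1 H).
  apply/existsP/existsP => -[[a b] /=]; rewrite !xpair_eqE => /and4P[H1 H2 H3 H4];
    exists (a, b); rewrite /= !xpair_eqE H1 H2 H3 /=; move: H4;
    by rewrite conjgE (invol _ _ H3) mulgA.
split=> [isoG | isoG rT H]; last by rewrite -relE; apply: eq_homgr.
by rewrite isogEhom relE -!isoG homg_refl isoG -relE homg_refl.
Qed.

(* Main.v *)
Require Import Defs.
From HB Require Import structures.
From mathcomp Require Import all_boot all_order all_algebra all_fingroup.
From mathcomp Require Import all_solvable.
From mathcomp Require Import ring zify.

Set Implicit Arguments.
Unset Strict Implicit.
Unset Printing Implicit Defensive.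

Import Order.TTheory GRing.Theory Num.Theory.
Local Open Scope ring_scope.

(** A pair of elements generates exactly one subgroup, so the graph is a
disjoint union of stars: the subgroup [H] is the centre of a star whose leaves
are the pairs generating [H]. All four invariants then depend only on the
family of numbers [d_H] of generating pairs, and the proof has two halves.

Spectra of star forests. Let [M] be the number of leaves, [N] the number of
centres and [F] the leaf-centre incidence matrix. Every leaf has one
neighbour, so [F^T F] is the diagonal matrix of the [d_H]. A bordered
determinant ([det_bordered]) turns this into the characteristic polynomials of
the adjacency matrix and of both Laplacians, and its other Schur complement
([det_scalar_sub_gram]) into that of the common neighbourhood matrix, whose
leaf block is [F F^T - 1]. The eigenvalues are: for the adjacency matrix
[+- sqrt d_H]; for both Laplacians [0] and [d_H + 1]; for the common
neighbourhood matrix [0] and [d_H - 1]; and in each case one further constant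
eigenvalue ([0], [1] and [-1] respectively) of multiplicity [M - N]. Since
the average degree [2 M / (M + N)] lies between [1] and [2], every absolute
value has a known sign: the energy is the sum of the [2 sqrt d_H], both
Laplacian energies are [2 (M^2 + N^2) / (M + N)], and the common neighbourhood
energy is [2 (M - N)].

Subgroups of a dihedral group. Let [R] be the rotation subgroup, of order [n].
A subgroup not inside [R] is determined by its rotations [K] together with any
one of its reflections, so exactly [n / |K|] such subgroups have rotation part
[K]. Such a subgroup is generated by a reflection and a generator of [K], in
either order, or by two reflections whose product generates [K]: these are
[3 |K| totient(|K|)] pairs. Hence a sum of [f d_H] over all subgroups becomes
a sum over the subgroups of [R] ([sum_subgroups_dihedral]). For [n = p^2] these
have orders [1], [p], [p^2], and a cyclic group of order [p^(k+1)] has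
[p^(2k+2) - p^(2k)] generating pairs, the pairs outside its maximal subgroup.
This gives [M = 4 p^4], [N = p^2 + p + 4] and the six kinds of star
([sum_subgroups_dihedral_prime_square]). *)

(** * Block determinants *)

Section BlockDeterminants.
Variables (R : comNzRingType) (m n : nat) (F : 'M[R]_(m, n)) (d : 'rV[R]_n).
Hypothesis FtF : F^T *m F = diag_mx d.

(** Multiplying on the right by [[1, - s F], [0, a]] clears the upper right
block; the lower right one becomes diagonal because [F^T F] is. The factor
[a ^+ n] avoids dividing by [a], which later is a polynomial. *)
Lemma det_bordered (a s : R) (e : 'rV[R]_n) :
  \det (block_mx a%:M (s *: F) (s *: F^T) (diag_mx e)) * a ^+ n
    = a ^+ m * \prod_j (a * e 0 j - s ^+ 2 * d 0 j).
Proof.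
have <- : \det (block_mx 1%:M (- s *: F) 0 (a%:M : 'M_n)) = a ^+ n.
  by rewrite det_ublock det1 mul1r det_scalar.
rewrite -det_mulmx mulmx_block !mulmx1 !mulmx0 !addr0 mul_scalar_mx mul_mx_scalar.
rewrite -scalerDr [- s *: F]scaleNr addNr scaler0.
rewrite det_lblock det_scalar; congr (_ * _).
rewrite mulmxN -scalemxAl -scalemxAr FtF scalerA mul_mx_scalar.
transitivity (\det (diag_mx (\row_j (a * e 0 j - s ^+ 2 * d 0 j)))).
  congr (\det _); apply/matrixP=> i j; rewrite !mxE.
  by case: eqP => [->|_]; rewrite ?mulr0n ?mulr1n; ring.
by rewrite det_diag; apply: eq_bigr => j _; rewrite !mxE.
Qed.

(** The left-hand determinant is the other Schur complement of a bordered
matrix with identity lower right block. *)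
Lemma det_scalar_sub_gram (a : R) :
  \det (a%:M - F *m F^T) * a ^+ n = a ^+ m * \prod_j (a - d 0 j).
Proof.
have -> : \det (a%:M - F *m F^T)
    = \det (block_mx a%:M (1 *: F) (1 *: F^T) (diag_mx (const_mx 1))).
  have <- : \det (block_mx a%:M (1 *: F) (1 *: F^T) (diag_mx (const_mx 1))
      *m block_mx 1%:M 0 (- F^T) 1%:M) = \det (a%:M - F *m F^T).
    rewrite mulmx_block !mulmx1 !mulmx0 !scale1r diag_const_mx !add0r.
    by rewrite mul1mx subrr mulmxN det_ublock det1 mulr1.
  by rewrite det_mulmx det_lblock !det1 !mulr1.
rewrite det_bordered; congr (_ * _).
by apply: eq_bigr => j _; rewrite !mxE; ring.
Qed.

End BlockDeterminants.

Lemma det_reindex (R : comNzRingType) m n (f : 'I_m -> 'I_n) (A : 'M[R]_n) :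
  bijective f -> \det (\matrix_(i, j) A (f i) (f j)) = \det A.
Proof.
move=> bij_f; have eq_mn : m = n.
  by rewrite -[m]card_ord -[n]card_ord; apply: bij_eq_card bij_f.
case: _ / eq_mn in f A bij_f *.
pose s := perm (bij_inj bij_f).
have -> : (\matrix_(i, j) A (f i) (f j)) = row_perm s (col_perm s A).
  by apply/matrixP=> i j; rewrite !mxE !permE.
rewrite row_permE col_permE !det_mulmx !det_perm odd_permV mulrCA.
by rewrite -signr_addb addbb mulr1.
Qed.

(** * Matrices indexed by a disjoint union *)

Section SumIndex.
Variables X L : finType.

(** The enumeration of [X + L] listing the elements of [X] first; it makes the
block structure of a matrix over the vertices visible. *)
Definition sum_index (k : 'I_(#|X| + #|L|)) : 'I_#|{: X + L}| :=
  enum_rank (match split k with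
             | inl i => inl (enum_val i) | inr j => inr (enum_val j) end).

Lemma sum_index_bij : bijective sum_index.
Proof.
exists (fun k => match enum_val k with
                 | inl x => lshift _ (enum_rank x)
                 | inr y => rshift _ (enum_rank y) end) => k.
  by rewrite /sum_index enum_rankK; case: split_ordP => i ->; rewrite enum_valK.
rewrite /sum_index -[RHS]enum_valK; case: (enum_val k) => x.
  by case: split_ordP => i /eqP; rewrite ?eq_lrshift // eq_lshift => /eqP<-; rewrite enum_rankK.
by case: split_ordP => i /eqP; rewrite ?eq_rlshift // eq_rshift => /eqP<-; rewrite enum_rankK.
Qed.

Lemma det_sum_index (R : comNzRingType) (A : 'M[R]_#|{: X + L}|) :
  \det A = \det (block_mx
    (\matrix_(i < #|X|, j < #|X|)
       A (enum_rank (inl (enum_val i))) (enum_rank (inl (enum_val j))))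
    (\matrix_(i < #|X|, j < #|L|)
       A (enum_rank (inl (enum_val i))) (enum_rank (inr (enum_val j))))
    (\matrix_(i < #|L|, j < #|X|)
       A (enum_rank (inr (enum_val i))) (enum_rank (inl (enum_val j))))
    (\matrix_(i < #|L|, j < #|L|)
       A (enum_rank (inr (enum_val i))) (enum_rank (inr (enum_val j))))).
Proof.
rewrite -(det_reindex A sum_index_bij); congr (\det _).
apply/matrixP=> i j; rewrite !mxE /sum_index.
by case: split_ordP => i' _; rewrite !mxE; case: split_ordP => j' _; rewrite !mxE.
Qed.

End SumIndex.

(** * Spectra and energies of star forests *)

Section StarForest.
Variables (X L : finType) (f : X -> L).
Variable adjr : rel (X + L)%type.
Hypotheses (adjr_sym : symmetric adjr) (adjr_irr : irreflexive adjr).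
Hypothesis adjrE : forall u v, adjr u v = match u, v with
  | inl x, inr H | inr H, inl x => f x == H
  | _, _ => false end.

Let Gamma : sgraph := SGraph adjr_sym adjr_irr.

Definition fiber_card (H : L) : nat := #|[set x | f x == H]|.

Lemma degree_leaf x : degree (inl x : Gamma) = 1%N.
Proof.
rewrite /degree -(cards1 (inr (f x) : Gamma)); apply: eq_card => w.
by rewrite !inE /= adjrE; case: w => // H; rewrite eq_sym.
Qed.

Lemma degree_center H : degree (inr H : Gamma) = fiber_card H.
Proof.
rewrite /degree /fiber_card -(card_imset _ (@inl_inj X L)).
apply: eq_card => w; rewrite !inE /= adjrE.
apply/idP/imsetP => [|[x]]; last by rewrite inE => ? ->.
by case: w => // x fx; exists x; rewrite ?inE.
Qed.

Lemma num_edges_star : num_edges Gamma = #|X|.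
Proof.
pose h x : {set Gamma} := [set inl x; inr (f x)].
have inj_h : injective h.
  move=> x y /setP/(_ (inl x)); rewrite !inE eqxx /= orbF.
  by move/esym/eqP=> [].
rewrite /num_edges -cardsT -(card_imset _ inj_h).
apply: eq_card => e; rewrite !inE; apply/existsP/imsetP.
  case=> u /existsP[v /andP[/=]]; rewrite adjrE.
  case: u v => [x|H] [y|K] // /eqP<- /eqP->.
    by exists x.
  by exists y => //; rewrite setUC.
case=> x _ ->; exists (inl x); apply/existsP; exists (inr (f x)).
by rewrite /= adjrE !eqxx.
Qed.

Lemma num_vertices_star : num_vertices Gamma = (#|X| + #|L|)%N.
Proof. exact: card_sum. Qed.

Lemma sum_fiber_card : (\sum_H fiber_card H)%N = #|X|.
Proof.
rewrite -sum1_card (partition_big f predT) //=.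
by apply: eq_bigr => H _; rewrite sum1dep_card.
Qed.

Section Spectra.
Variable C : numClosedFieldType.

Definition incidence_mx (R : comNzRingType) : 'M[R]_(#|X|, #|L|) :=
  \matrix_(i, j) (f (enum_val i) == enum_val j)%:R.

Lemma incidence_gram (R : comNzRingType) :
  (incidence_mx R)^T *m incidence_mx R
    = diag_mx (\row_j (fiber_card (enum_val j))%:R).
Proof.
apply/matrixP=> i j; rewrite !mxE.
transitivity (\sum_(k < #|X|) ((f (enum_val k) == enum_val j)%:R *+ (i == j)) : R).
  apply: eq_bigr => k _; rewrite !mxE.
  have [-> | ne_ij] := eqVneq i j; first by rewrite -natrM mulnb andbb.
  have [-> | _] := eqVneq (f _) (enum_val i); last by rewrite mul0r.
  by rewrite (inj_eq enum_val_inj) (negPf ne_ij) mulr0.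
rewrite sumrMnl; have [-> | _] := eqVneq i j; last by rewrite !mulr0n.
rewrite !mulr1n.
rewrite -(big_enum_val (fun x => (f x == enum_val j)%:R)) /= -natr_sum.
by rewrite /fiber_card -sum1dep_card [in RHS]big_mkcond.
Qed.

(** Factors are moved to the left-hand side, as repeated elements of [s], so
that multiplicities such as [#|X| - #|L|] never need a subtraction. *)
Lemma perm_spectrum (A : 'M[C]_#|Gamma|) (s t : seq C) :
  char_poly A * \prod_(z <- s) ('X - z%:P) = \prod_(z <- t) ('X - z%:P) ->
  perm_eq (spectrum A ++ s) t.
Proof.
rewrite char_poly_spectrum -big_cat /= => eq_st.
by apply/allP=> z _; apply/eqP; rewrite -!mu_prod_XsubC eq_st.
Qed.

Lemma prod_star_roots c (r1 r2 : L -> C) :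
  \prod_(z <- nseq #|X| c ++ codom r1 ++ codom r2) ('X - z%:P)
  = ('X - c%:P) ^+ #|X| * \prod_H (('X - (r1 H)%:P) * ('X - (r2 H)%:P)).
Proof.
by rewrite !big_cat /= big_nseq -Monoid.iteropE /= !big_image big_split.
Qed.

(** One computation serves three matrices: the adjacency matrix is the case
[c = 0], [s = 1], [e = 0], and the Laplacians are [c = 1], [s = -1] or [1], and
[e H] the degree of [H]. Only [s ^+ 2] enters the result, which is why the two
Laplacians are cospectral. *)
Lemma char_poly_star (A : 'M[C]_#|{: X + L}|) (c s : C) (e : L -> C) :
    s ^+ 2 = 1 ->
    (forall x y, A (enum_rank (inl x)) (enum_rank (inl y)) = c *+ (x == y)) ->
    (forall x H, A (enum_rank (inl x)) (enum_rank (inr H)) = s *+ (f x == H)) ->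
    (forall H x, A (enum_rank (inr H)) (enum_rank (inl x)) = s *+ (f x == H)) ->
    (forall H K, A (enum_rank (inr H)) (enum_rank (inr K)) = e H *+ (H == K)) ->
  char_poly A * ('X - c%:P) ^+ #|L|
  = ('X - c%:P) ^+ #|X|
    * \prod_H (('X - c%:P) * ('X - (e H)%:P) - (fiber_card H)%:R).
Proof.
move=> s2 Axx AxH AHx AHH.
have blocks : char_poly A = \det (block_mx ('X - c%:P)%:M
    ((- s%:P) *: incidence_mx {poly C}) ((- s%:P) *: (incidence_mx {poly C})^T)
    (diag_mx (\row_j ('X - (e (enum_val j))%:P)))).
  rewrite /char_poly det_sum_index; congr (\det (block_mx _ _ _ _));
    apply/matrixP=> i j; rewrite !mxE (inj_eq enum_rank_inj).
  - rewrite Axx (inj_eq inl_inj) (inj_eq enum_val_inj).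
    by case: (i == j); rewrite ?mulr1n ?mulr0n ?subr0.
  - by rewrite AxH; case: (_ == enum_val _) => /=; rewrite sub0r ?mulr1 ?mulr0 ?oppr0.
  - by rewrite AHx; case: (_ == enum_val _) => /=; rewrite sub0r ?mulr1 ?mulr0 ?oppr0.
  - rewrite AHH (inj_eq inr_inj) (inj_eq enum_val_inj).
    by case: (i == j); rewrite ?mulr1n ?mulr0n ?subr0.
rewrite blocks (det_bordered (incidence_gram _)); congr (_ * _).
rewrite [RHS]big_enum_val /=; apply: eq_bigr => j _; rewrite !mxE sqrrN.
by rewrite -rmorphXn /= s2 mul1r.
Qed.

(** The hypotheses on [r1] and [r2] are Vieta's formulas for the quadratic
factor attached to the star of centre [H]. *)
Lemma perm_spectrum_star (A : 'M[C]_#|{: X + L}|) (c s : C) (e r1 r2 : L -> C) :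
    s ^+ 2 = 1 ->
    (forall x y, A (enum_rank (inl x)) (enum_rank (inl y)) = c *+ (x == y)) ->
    (forall x H, A (enum_rank (inl x)) (enum_rank (inr H)) = s *+ (f x == H)) ->
    (forall H x, A (enum_rank (inr H)) (enum_rank (inl x)) = s *+ (f x == H)) ->
    (forall H K, A (enum_rank (inr H)) (enum_rank (inr K)) = e H *+ (H == K)) ->
    (forall H, r1 H + r2 H = c + e H) ->
    (forall H, r1 H * r2 H = c * e H - (fiber_card H)%:R) ->
  perm_eq (spectrum A ++ nseq #|L| c) (nseq #|X| c ++ codom r1 ++ codom r2).
Proof.
move=> s2 Axx AxH AHx AHH r_sum r_prod; apply: perm_spectrum.
rewrite prod_star_roots big_nseq -Monoid.iteropE /=.
rewrite (char_poly_star s2 Axx AxH AHx AHH); congr (_ * _).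
apply: eq_bigr => H _.
have -> : ('X - (r1 H)%:P) * ('X - (r2 H)%:P)
    = 'X ^+ 2 - (r1 H + r2 H)%:P * 'X + (r1 H * r2 H)%:P.
  by rewrite !rmorphD !rmorphM /=; ring.
by rewrite r_sum r_prod !rmorphD rmorphN rmorphM rmorph_nat /=; ring.
Qed.

Lemma sum_perm_star (V : nmodType) (g : C -> V) (t : seq C) c (r1 r2 : L -> C) :
  perm_eq (t ++ nseq #|L| c) (nseq #|X| c ++ codom r1 ++ codom r2) ->
  \sum_(z <- t) g z + g c *+ #|L|
    = g c *+ #|X| + \sum_H (g (r1 H) + g (r2 H)).
Proof.
have sum_nseq k : \sum_(z <- nseq k c) g z = g c *+ k.
  by rewrite big_nseq -Monoid.iteropE.
move=> eq_t; rewrite -!sum_nseq -big_cat (perm_big _ eq_t) /=.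
by rewrite !big_cat /= !big_image -big_split.
Qed.

Lemma perm_spectrum_adjacency :
  perm_eq (spectrum (adjacency_mx C Gamma) ++ nseq #|L| 0)
    (nseq #|X| 0 ++ codom (fun H => sqrtC (fiber_card H)%:R)
                 ++ codom (fun H => - sqrtC (fiber_card H)%:R)).
Proof.
apply: (@perm_spectrum_star _ 0 1 (fun=> 0)); first by rewrite expr1n.
- by move=> x y; rewrite !mxE !enum_rankK /= adjrE mul0rn.
- by move=> x H; rewrite !mxE !enum_rankK /= adjrE.
- by move=> x H; rewrite !mxE !enum_rankK /= adjrE.
- by move=> x H; rewrite !mxE !enum_rankK /= adjrE mul0rn.
- by move=> H; rewrite subrr addr0.
- by move=> H; rewrite mul0r sub0r mulrN -expr2 sqrtCK.
Qed.

Lemma perm_spectrum_laplacian_sign (s : C) :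
  s ^+ 2 = 1 ->
  perm_eq (spectrum (degree_mx C Gamma + s *: adjacency_mx C Gamma) ++ nseq #|L| 1)
    (nseq #|X| 1 ++ codom (fun _ : L => 0) ++ codom (fun H => (fiber_card H).+1%:R)).
Proof.
move=> s2; apply: (@perm_spectrum_star _ 1 s (fun H => (fiber_card H)%:R)) => //.
- move=> x y; rewrite !mxE !enum_rankK degree_leaf (inj_eq enum_rank_inj).
  by rewrite (inj_eq inl_inj) /= adjrE mulr0 addr0.
- move=> x H; rewrite !mxE !enum_rankK (inj_eq enum_rank_inj) /= adjrE.
  by rewrite mulr0n add0r mulr_natr.
- move=> x H; rewrite !mxE !enum_rankK (inj_eq enum_rank_inj) /= adjrE.
  by rewrite mulr0n add0r mulr_natr.
- move=> H K; rewrite !mxE !enum_rankK degree_center (inj_eq enum_rank_inj).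
  by rewrite (inj_eq inr_inj) /= adjrE mulr0 addr0.
- by move=> H; rewrite add0r -natr1 addrC.
- by move=> H; rewrite mul0r mul1r subrr.
Qed.

Lemma card_common_neighbors_leaves x y :
  x != y -> #|common_neighbors (inl x : Gamma) (inl y)| = (f x == f y).
Proof.
move=> ne_xy; case: eqVneq => [eq_f | ne_f].
  rewrite -[RHS](cards1 (inr (f x) : Gamma)); apply: eq_card => w.
  rewrite !inE /= !adjrE; case: w => [z | H]; first by rewrite !andbF.
  by rewrite -eq_f andbb eq_sym.
apply: eq_card0 => w; rewrite !inE /= !adjrE.
case: w => [z | H]; first by rewrite !andbF.
by apply/negP=> /and4P[_ _ /eqP fx /eqP fy]; rewrite fx fy eqxx in ne_f.
Qed.

Lemma card_common_neighbors_centers H K :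
  H != K -> #|common_neighbors (inr H : Gamma) (inr K)| = 0%N.
Proof.
move=> ne_HK; apply: eq_card0 => w; rewrite !inE /= !adjrE.
case: w => [z | w]; last by rewrite !andbF.
by apply/negP=> /and4P[_ _ /eqP fH /eqP fK]; rewrite -fH fK eqxx in ne_HK.
Qed.

Lemma card_common_neighbors_mixed x H :
  #|common_neighbors (inl x : Gamma) (inr H)| = 0%N.
Proof.
by apply: eq_card0 => w; rewrite !inE /= !adjrE; case: w => w; rewrite !andbF.
Qed.

Lemma common_neighborsC u v :
  common_neighbors (u : Gamma) v = common_neighbors v u.
Proof.
by apply/setP=> w; rewrite !inE andbCA [adj u w && _]andbC.
Qed.

Lemma perm_spectrum_cn :
  perm_eq (spectrum (cn_mx C Gamma) ++ nseq #|L| (-1))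
    (nseq #|X| (-1) ++ codom (fun _ : L => 0) ++ codom (fun H => (fiber_card H)%:R - 1)).
Proof.
apply: perm_spectrum; rewrite prod_star_roots big_nseq -Monoid.iteropE /=.
set F := incidence_mx {poly C}.
(* Two leaves have a common neighbour exactly when they have the same centre,
   which is the corresponding entry of [F F^T]. *)
have blocks : char_poly (cn_mx C Gamma)
    = \det (block_mx (('X + 1)%:M - F *m F^T) 0 0 ('X%:M : 'M_#|L|)).
  rewrite /char_poly det_sum_index; congr (\det (block_mx _ _ _ _));
    apply/matrixP=> i j; rewrite !mxE (inj_eq enum_rank_inj) ?enum_rankK.
  - have -> : \sum_k F i k * F^T k j
        = (f (enum_val i) == f (enum_val j))%:R :> {poly C}.
      rewrite (bigD1 (enum_rank (f (enum_val i)))) //= !mxE enum_rankK eqxx mul1r.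
      rewrite big1 ?addr0 1?eq_sym // => k ne_k; rewrite !mxE.
      case: eqP => [fk | _]; last by rewrite mul0r.
      by rewrite fk enum_valK eqxx in ne_k.
    rewrite (inj_eq inl_inj) (inj_eq enum_val_inj).
    have [-> | ne_ij] := eqVneq i j.
      by rewrite eqxx !mulr1n polyC0; ring.
    rewrite card_common_neighbors_leaves ?(inj_eq enum_val_inj) //.
    by rewrite !mulr0n !sub0r polyC_natr.
  - by rewrite card_common_neighbors_mixed polyC0 subr0.
  - by rewrite common_neighborsC card_common_neighbors_mixed polyC0 subr0.
  - rewrite (inj_eq inr_inj) (inj_eq enum_val_inj).
    have [_ | ne_ij] := eqVneq i j; first by rewrite polyC0 subr0.
    rewrite card_common_neighbors_centers ?(inj_eq enum_val_inj) //.
    by rewrite polyC0 subr0.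
have -> : 'X - (-1)%:P = 'X + 1 :> {poly C} by rewrite polyCN opprK.
rewrite blocks det_ublock det_scalar mulrAC (det_scalar_sub_gram (incidence_gram _)).
rewrite -mulrA; congr (_ * _).
rewrite [in RHS](eq_bigr (fun H => 'X * ('X + 1 - (fiber_card H)%:R))); last first.
  by move=> H _; rewrite rmorphB rmorph_nat ?polyC0 ?polyC1 /=; ring.
rewrite big_split prodr_const /= mulrC; congr (_ * _).
by rewrite [RHS]big_enum_val /=; apply: eq_bigr => j _; rewrite !mxE.
Qed.

Lemma energy_star :
  energy C Gamma = \sum_H 2 * sqrtC (fiber_card H)%:R.
Proof.
have := sum_perm_star (fun z => `|z|) perm_spectrum_adjacency.
rewrite normr0 !mul0rn addr0 add0r /energy => ->.
apply: eq_bigr => H _; rewrite normrN ger0_norm ?sqrtC_ge0 ?ler0n //.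
by rewrite mulr_natl.
Qed.

Hypothesis fiber_gt0 : forall H, (0 < fiber_card H)%N.

Lemma leq_card_centers : (#|L| <= #|X|)%N.
Proof. by rewrite -sum_fiber_card -sum1_card leq_sum. Qed.

Lemma cn_energy_star :
  cn_energy C Gamma = 2 * #|X|%:R - 2 * #|L|%:R.
Proof.
have := sum_perm_star (fun z => `|z|) perm_spectrum_cn.
rewrite normrN1 -/(cn_energy C Gamma) => /(canRL (addrK _)) ->.
rewrite (eq_bigr (fun H => (fiber_card H)%:R - 1)) => [|H _]; last first.
  by rewrite normr0 add0r ger0_norm // subr_ge0 ler1n.
by rewrite big_split /= -natr_sum sum_fiber_card sumr_const cardT -cardE mulNrn; ring.
Qed.

(** The average degree [r] lies in [[1, 2]], and every [d_H + 1] is at least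
[2]. So the two exceptional eigenvalues of each star contribute
[r + (d_H + 1 - r)], that is [d_H + 1], and the others contribute [r - 1] each,
[#|X| - #|L|] times. *)
Lemma laplacian_sign_energy_star (s : C) :
    (0 < #|X|)%N -> s ^+ 2 = 1 ->
  \sum_(z <- spectrum (degree_mx C Gamma + s *: adjacency_mx C Gamma))
     `|z - average_degree C Gamma|
  = 2 * (#|X|%:R ^+ 2 + #|L|%:R ^+ 2) / (#|X|%:R + #|L|%:R).
Proof.
move=> X_gt0 s2; rewrite /average_degree num_edges_star num_vertices_star natrD.
set M : C := #|X|%:R; set N : C := #|L|%:R; set r := 2 * M / (M + N).
have M_gt0 : 0 < M by rewrite ltr0n.
have N_ge0 : 0 <= N by rewrite ler0n.
have le_NM : N <= M by rewrite ler_nat leq_card_centers.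
have MN_gt0 : 0 < M + N by rewrite ltr_wpDr.
have r_ge1 : 1 <= r by rewrite ler_pdivlMr // mul1r mulr_natl lerD2l.
have r_le2 : r <= 2 by rewrite ler_pdivrMr // ler_pM2l ?ltr0n // lerDl.
have r_ge0 : 0 <= r := le_trans ler01 r_ge1.
have := sum_perm_star (fun z => `|z - r|) (perm_spectrum_laplacian_sign s2).
move=> /(canRL (addrK _)) ->.
rewrite distrC ger0_norm ?subr_ge0 //.
rewrite (eq_bigr (fun H => (fiber_card H)%:R + 1)) => [|H _]; last first.
  rewrite sub0r normrN !ger0_norm // ?subr_ge0.
    by rewrite -natr1; ring.
  by rewrite (le_trans r_le2) // ler_nat ltnS.
rewrite big_split /= -natr_sum sum_fiber_card sumr_const.
rewrite -[_ *+ #|X|]mulr_natr -[(r - 1) *+ _]mulr_natr -/M -/N /r; field; exact: lt0r_neq0.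
Qed.

Lemma laplacian_energy_star : (0 < #|X|)%N ->
  laplacian_energy C Gamma
  = 2 * (#|X|%:R ^+ 2 + #|L|%:R ^+ 2) / (#|X|%:R + #|L|%:R).
Proof.
move=> X_gt0; rewrite -(laplacian_sign_energy_star X_gt0 (s := -1)) ?sqrrN ?expr1n //.
by rewrite scaleN1r.
Qed.

Lemma signless_laplacian_energy_star : (0 < #|X|)%N ->
  signless_laplacian_energy C Gamma
  = 2 * (#|X|%:R ^+ 2 + #|L|%:R ^+ 2) / (#|X|%:R + #|L|%:R).
Proof.
move=> X_gt0; rewrite -(laplacian_sign_energy_star X_gt0 (s := 1)) ?expr1n //.
by rewrite scale1r.
Qed.

End Spectra.
End StarForest.

(** * Generating pairs in cyclic groups of prime power order *)

Section GeneratingPairs.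
Variable gT : finGroupType.
Implicit Types (G H K : {group gT}) (x y a : gT).
Local Open Scope group_scope.

Definition generating_pairs H : {set gT * gT} :=
  [set u | <<[set u.1; u.2]>> == H].

Lemma mem_generating_pairs H x y :
  ((x, y) \in generating_pairs H) = (<[x]> <*> <[y]> == H).
Proof. by rewrite inE /= joing_idl joing_idr. Qed.

Lemma card_generating_pairs1 : #|generating_pairs 1%G| = 1%N.
Proof.
rewrite -(cards1 (1 : gT, 1 : gT)); apply: eq_card => -[x y].
rewrite mem_generating_pairs inE xpair_eqE -!cycle_eq1.
apply/eqP/andP=> [xy1 | [/eqP-> /eqP->]]; last by rewrite joing1G.
by rewrite -!subG1 -xy1 joing_subl joing_subr.
Qed.

(** The subgroups of a cyclic p-group form a chain, so a pair fails to generate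
exactly when both its entries lie in the unique maximal subgroup. *)
Lemma card_generating_pairs_cyclic_pgroup (p k : nat) K :
  prime p -> cyclic K -> #|K| = (p ^ k.+1)%N ->
  #|generating_pairs K| = (p ^ k.+1 * p ^ k.+1 - p ^ k * p ^ k)%N.
Proof.
move=> p_pr cycK oK; have [a defK] := cyclicP cycK.
have p_gt0 := prime_gt0 p_pr; have oa : #[a] = (p ^ k.+1)%N by rewrite orderE -defK.
pose M := <[a ^+ p]>%G.
have sMK : M \subset K by rewrite defK cycleX.
have oM : #|M| = (p ^ k)%N.
  by rewrite -orderE orderXdiv oa ?expnS ?mulKn // dvdn_mulr.
have -> : generating_pairs K = setX K K :\: setX M M.
  apply/setP=> -[x y]; rewrite mem_generating_pairs !inE /=.
  have [/andP[Kx Ky] | nKxy] := boolP ((x \in K) && (y \in K)); last first.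
    rewrite andbF; apply: contraNF nKxy => /eqP defKxy.
    by rewrite -!cycle_subG -defKxy joing_subl joing_subr.
  have sHK : <[x]> <*> <[y]> \subset K by rewrite join_subG !cycle_subG Kx.
  rewrite andbT -!cycle_subG -join_subG.
  rewrite -(cardSg_cyclic cycK sHK sMK) oM (eq_subG_cyclic cycK sHK (subxx K)) oK.
  have /(dvdn_pfactor _ _ p_pr)[j le_jk ->] : (#|<[x]> <*> <[y]>| %| p ^ k.+1)%N.
    by rewrite -oK cardSg.
  by rewrite eqn_exp2l ?prime_gt1 // dvdn_Pexp2l ?prime_gt1 // -ltnNge eqn_leq le_jk.
rewrite cardsD (setIidPr _) ?cardsX ?oK ?oM //.
by apply/subsetP=> -[x y] /setXP[Mx My]; rewrite !inE /= !(subsetP sMK).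
Qed.

Lemma sum_subgroups_cyclic_pgroup (V : nmodType) (F : nat -> V) (p m : nat) K :
    prime p -> cyclic K -> #|K| = (p ^ m)%N ->
  (\sum_(H : {group gT} | H \subset K) F #|H| = \sum_(i < m.+1) F (p ^ i)%N)%R.
Proof.
move=> p_pr cycK oK; have [a defK] := cyclicP cycK.
have oa : #[a] = (p ^ m)%N by rewrite orderE -defK.
have card_sub H : H \subset K -> exists2 i : 'I_m.+1, #|H| = (p ^ i)%N
    & inord (logn p #|H|) = i.
  move/cardSg; rewrite oK => /(dvdn_pfactor _ _ p_pr)[i le_im ->].
  exists (inord i); rewrite ?pfactorK // inordK //.
rewrite (partition_big (fun H => inord (logn p #|H|) : 'I_m.+1) predT) //=.
apply: eq_bigr => i _; pose Hi := <[a ^+ (#[a] %/ p ^ i)]>%G.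
have dvd_i : (p ^ i %| #[a])%N by rewrite oa dvdn_exp2l // -ltnS.
have oHi : #|Hi| = (p ^ i)%N.
  rewrite -orderE orderXdiv ?divnA ?mulKn ?dvdn_div //.
rewrite (big_pred1 Hi) ?oHi // => H /=; apply/andP/eqP=> [[sHK /eqP eq_i] | ->].
  have [j oH eq_j] := card_sub H sHK.
  apply: val_inj; apply/eqP; rewrite (eq_subG_cyclic cycK) //; last first.
    by rewrite defK cycleX.
  by rewrite oHi oH -eq_j eq_i.
split; first by rewrite defK cycleX.
by rewrite oHi pfactorK // inord_val.
Qed.

End GeneratingPairs.

(** * Subgroups of a dihedral group *)

Section DihedralSubgroups.
Variables (gT : finGroupType) (G R : {group gT}).
Implicit Types (H K : {group gT}) (x y t u : gT).
Local Open Scope group_scope.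

(* [R] plays the role of the rotation subgroup, and [G :\: R] is the set of
   reflections. *)
Hypothesis sRG : R \subset G.
Hypothesis cycR : cyclic R.
Hypothesis mulTT : forall t u, t \in G :\: R -> u \in G :\: R -> t * u \in R.
Hypothesis invT : forall t, t \in G :\: R -> t * t = 1.
Hypothesis conjT : forall t x, t \in G :\: R -> x \in R -> x ^ t = x^-1.
Hypothesis cardT : #|G :\: R| = #|R|.

Lemma reflection_normalises K t :
  K \subset R -> t \in G :\: R -> <[t]> \subset 'N(K).
Proof.
move=> sKR Tt; rewrite cycle_subG inE; apply/subsetP=> _ /imsetP[x Kx ->].
by rewrite (conjT Tt (subsetP sKR x Kx)) groupV.
Qed.

Lemma join_reflection_rotations K t :
  K \subset R -> t \in G :\: R -> (K <*> <[t]>) :&: R = K.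
Proof.
move=> sKR Tt; have /setDP[Gt nRt] := Tt.
rewrite norm_joinEr ?reflection_normalises // -group_modl //.
suffices -> : <[t]> :&: R = 1 by rewrite mulg1.
have ot : #[t] = 2.
  apply: nt_prime_order => //; first by rewrite expgS expg1 invT.
  by apply: contraNneq nRt => ->; apply: group1.
by apply: prime_TIg; rewrite -?orderE ?ot // cycle_subG.
Qed.

Lemma subgroup_eq_join_reflection H t :
  H \subset G -> t \in H :\: R -> H :=: (H :&: R) <*> <[t]>.
Proof.
move=> sHG /setDP[Ht nRt]; apply/eqP; rewrite eqEsubset join_subG subsetIl.
rewrite cycle_subG Ht !andbT; apply/subsetP=> u Hu.
have [Ru | nRu] := boolP (u \in R).
  by apply: (subsetP (joing_subl _ _)); rewrite inE Hu.
rewrite -(mulgK t u) groupM ?groupV //; last first.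
  by apply: (subsetP (joing_subr _ _)); apply: cycle_id.
apply: (subsetP (joing_subl _ _)); rewrite inE groupM //=.
by apply: mulTT; rewrite !inE ?nRu ?nRt (subsetP sHG).
Qed.

Lemma card_reflections H :
  H \subset G -> ~~ (H \subset R) -> #|H :\: R| = #|H :&: R|.
Proof.
move=> sHG /subsetPn[t Ht nRt]; rewrite -(card_rcoset (H :&: R) t).
have Tt : t \in G :\: R by rewrite inE nRt (subsetP sHG).
apply: eq_card => u; rewrite mem_rcoset !inE groupMr ?groupV // andbC.
apply: andb_id2l => Hu; apply/idP/idP => [nRu | Rut].
  have -> : t^-1 = t by apply/eqP; rewrite eq_invg_mul invT.
  by rewrite mulTT // inE nRu (subsetP sHG).
by apply: contra nRt => Ru; rewrite -[t]invgK groupV -(groupMl _ Ru).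
Qed.

(** Each reflection [t] of [G] lies in exactly one subgroup with rotation part
[K], namely [K <*> <[t]>], and each such subgroup contains [#|K|] reflections;
so the product on the left counts the reflections of [G]. *)
Lemma card_subgroups_over_rotations K :
  K \subset R ->
  (#|[set H : {group gT} | [&& H \subset G, ~~ (H \subset R) & H :&: R == K]]|
     * #|K| = #|R|)%N.
Proof.
move=> sKR; rewrite -[RHS]cardT -[RHS]sum1_card -sum_nat_const.
rewrite [RHS](partition_big (fun t => (K <*> <[t]>)%G)
  (mem [set H : {group gT} | [&& H \subset G, ~~ (H \subset R) & H :&: R == K]])) /=.
  apply: eq_bigr => H; rewrite inE => /and3P[sHG nsHR /eqP defK].
  rewrite -defK -card_reflections // -sum1_card; apply: eq_bigl => t.
  apply/idP/andP=> [HRt | [Tt /eqP <-]].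
    have /setDP[Ht nRt] := HRt; rewrite inE nRt (subsetP sHG) //; split=> //.
    by apply/eqP/val_inj; rewrite /= -subgroup_eq_join_reflection.
  have /setDP[_ nRt] := Tt.
  by rewrite inE nRt; apply: (subsetP (joing_subr _ _)); apply: cycle_id.
move=> t Tt; have /setDP[Gt nRt] := Tt; rewrite inE /= join_reflection_rotations // eqxx.
rewrite join_subG (subset_trans sKR sRG) cycle_subG Gt andbT /=.
by rewrite andbT; apply: contra nRt; rewrite join_subG -cycle_subG => /andP[].
Qed.

Lemma gen_rotation_reflection H x y :
    H \subset G -> ~~ (H \subset R) -> x \in H :\: R -> y \in H :&: R ->
  (<[x]> <*> <[y]> == H) = (<[y]> == H :&: R).
Proof.
move=> sHG nsHR HRx /setIP[Hy Ry]; have /setDP[Hx nRx] := HRx.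
have Tx : x \in G :\: R by rewrite inE nRx (subsetP sHG).
apply/eqP/eqP => [defH | defK].
  by rewrite -defH joingC join_reflection_rotations // cycle_subG.
by rewrite joingC defK -subgroup_eq_join_reflection.
Qed.

Lemma card_generators K : cyclic K -> #|[set x | <[x]> == K]| = totient #|K|.
Proof.
case/cyclicP=> a ->; rewrite -orderE totient_gen.
by apply: eq_card => x; rewrite !inE /generator eq_sym.
Qed.

(** In a generating pair at least one entry is a reflection. The pairs
(reflection, rotation) form the set [S] below; swapping the entries gives the
pairs (rotation, reflection), and the shear (x, y) -> (x, x y), which does not
change the generated subgroup, gives the pairs of two reflections. *)
Lemma card_generating_pairs_dihedral H :
    H \subset G -> ~~ (H \subset R) ->
  #|generating_pairs H| = (3 * (#|H :&: R| * totient #|H :&: R|))%N.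
Proof.
move=> sHG nsHR; set K := (H :&: R)%G.
have sKR : K \subset R := subsetIr H R.
pose S := setX (H :\: R) [set y | <[y]> == K].
have cardS : #|S| = (#|K| * totient #|K|)%N.
  by rewrite cardsX card_reflections // card_generators // (cyclicS sKR).
pose swap (u : gT * gT) := (u.2, u.1).
pose shear (u : gT * gT) := (u.1, u.1 * u.2).
have inj_swap : injective swap by move=> [x y] [x' y'] [-> ->].
have inj_shear : injective shear by move=> [x y] [x' y'] [-> /mulgI->].
have memS x y : ((x, y) \in S) = [&& x \in H, x \notin R, y \in R
    & (x, y) \in generating_pairs H].
  rewrite mem_generating_pairs !inE /=.
  have [Hx | _] := boolP (x \in H); last by rewrite andbF.
  have [//= | nRx /=] := boolP (x \in R).
  apply/idP/andP=> [defK | [Ry defH]].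
    have KRy : y \in H :&: R by rewrite -(eqP defK) cycle_id.
    have [_ Ry] := setIP KRy; rewrite gen_rotation_reflection //; last by rewrite inE nRx.
  have Hy : y \in H by rewrite -(eqP defH) -cycle_subG joing_subr.
  by rewrite -(@gen_rotation_reflection H x y) // inE ?nRx ?Hy.
have mem_swap x y : ((x, y) \in swap @: S) = ((y, x) \in S).
  by rewrite -[RHS](mem_imset _ _ inj_swap).
have mem_shear x y : ((x, y) \in shear @: S) = ((x, x^-1 * y) \in S).
  by rewrite -[RHS](mem_imset _ _ inj_shear) /shear /= mulKVg.
have gen_swap x y : ((y, x) \in generating_pairs H) = ((x, y) \in generating_pairs H).
  by rewrite !mem_generating_pairs joingC.
have gen_shear x y :
    ((x, x^-1 * y) \in generating_pairs H) = ((x, y) \in generating_pairs H).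
  have meml (z w : gT) : z \in <[z]> <*> <[w]> by rewrite -cycle_subG joing_subl.
  have memr (z w : gT) : w \in <[z]> <*> <[w]> by rewrite -cycle_subG joing_subr.
  rewrite !mem_generating_pairs; congr (_ == _); apply/eqP.
  rewrite eqEsubset !join_subG !joing_subl !cycle_subG /=; apply/andP; split.
    by rewrite groupM ?groupV ?meml ?memr.
  by have := groupM (meml x (x^-1 * y)) (memr x (x^-1 * y)); rewrite mulKVg.
have -> : generating_pairs H = S :|: (swap @: S :|: shear @: S).
  apply/setP=> -[x y]; rewrite 2!in_setU mem_swap mem_shear !memS (gen_swap x y) gen_shear.
  have [gen | _] := boolP ((x, y) \in _); last by rewrite !andbF.
  have {gen} /eqP defH : <[x]> <*> <[y]> == H by rewrite -mem_generating_pairs.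
  have Hx : x \in H by rewrite -defH -cycle_subG joing_subl.
  have Hy : y \in H by rewrite -defH -cycle_subG joing_subr.
  rewrite Hx Hy !andbT /=.
  have [Rx | nRx] := boolP (x \in R); have [Ry | nRy] := boolP (y \in R) => //=.
    by case/negP: nsHR; rewrite -defH join_subG !cycle_subG Rx.
  have Tx : x \in G :\: R by rewrite inE nRx (subsetP sHG).
  have Ty : y \in G :\: R by rewrite inE nRy (subsetP sHG).
  have -> : x^-1 = x by apply/eqP; rewrite eq_invg_mul invT.
  by rewrite mulTT.
have disj_shear : swap @: S :&: shear @: S = set0.
  apply/setP=> -[x y]; rewrite in_setI mem_swap mem_shear !memS !inE.
  by case: (x \in R); rewrite ?andbF.
have disj_S : S :&: (swap @: S :|: shear @: S) = set0.
  apply/setP=> -[x y]; rewrite in_setI in_setU mem_swap mem_shear !memS in_set0.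
  have [Rx | nRx] := boolP (x \in R); rewrite ?andbF //=.
  have [Ry | nRy] := boolP (y \in R); rewrite ?andbF //= groupMr // groupV.
  by rewrite (negPf nRx) !andbF.
rewrite cardsU disj_S cards0 subn0 cardsU disj_shear cards0 subn0.
by rewrite !card_imset // cardS !mulSn mul0n addn0.
Qed.

Lemma sum_subgroups_dihedral (V : nmodType) (F : nat -> V) :
  (\sum_(H : {group gT} | H \subset G) F #|generating_pairs H|
   = \sum_(K : {group gT} | K \subset R)
       (F #|generating_pairs K|
        + F (3 * (#|K| * totient #|K|))%N *+ (#|R| %/ #|K|)))%R.
Proof.
rewrite (bigID (fun H : {group gT} => H \subset R)) big_split /=; congr (_ + _)%R.
  apply: eq_bigl => H; apply: andb_idl => sHR; exact: subset_trans sHR sRG.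
rewrite (partition_big (fun H => H :&: R)%G (fun K : {group gT} => K \subset R)) /=.
  apply: eq_bigr => K sKR; rewrite -(card_subgroups_over_rotations sKR) mulnK //.
  rewrite -sumr_const; apply: eq_big => [H | H /andP[/andP[sHG nsHR] /eqP <-]].
    by rewrite inE -andbA.
  by rewrite card_generating_pairs_dihedral.
by move=> H _; apply: subsetIr.
Qed.



Lemma card_generating_pairs_gt0 H : H \subset G -> (0 < #|generating_pairs H|)%N.
Proof.
move=> sHG; have [sHR | nsHR] := boolP (H \subset R).
  have /cyclicP[a defH] := cyclicS sHR cycR.
  apply/card_gt0P; exists (a, 1).
  by rewrite mem_generating_pairs cycle1 joingG1 defH.
by rewrite card_generating_pairs_dihedral // !muln_gt0 cardG_gt0 totient_gt0 cardG_gt0.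
Qed.

End DihedralSubgroups.

(** * The rotation subgroup of a dihedral group *)

Section DihedralStructure.
Local Open Scope group_scope.

(** The relations only bound the orders of the images of [a] and [b] from above;
since [#|G| = 2 n], the bounds are attained. *)
Lemma dihedral_structure (n : nat) (gT : finGroupType) (G : {group gT}) :
    (1 < n)%N -> is_dihedral n G -> exists R : {group gT},
  [/\ R \subset G, cyclic R, #|R| = n, #|G :\: R| = n
    & [/\ forall t u, t \in G :\: R -> u \in G :\: R -> t * u \in R,
         forall t, t \in G :\: R -> t * t = 1
       & forall t x, t \in G :\: R -> x \in R -> x ^ t = x^-1]].
Proof.
move=> n_gt1 dihG; have oG : #|G| = n.*2.
  have /card_isog -> := (is_dihedralE G n_gt1).1 dihG.
  by rewrite mul2n card_dihedral.
have /existsP[[a b] /=] : (G \homg Grp (a : b : a ^+ n, b ^+ 2, b * a * b = a^-1))%g.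
  by rewrite -dihG homg_refl.
rewrite !xpair_eqE => /and4P[/eqP defG /eqP an /eqP b2 /eqP bab].
have bV : b^-1 = b by apply/eqP; rewrite eq_invg_mul -expg2 b2.
have ab : a ^ b = a^-1 by rewrite conjgE bV mulgA.
pose R := <[a]>%G.
have nRb : b \in 'N(R) by rewrite inE -cycleJ ab cycleV.
have defG' : R * <[b]> = G.
  by rewrite -defG norm_joinEr // cycle_subG.
have le_oa : (#[a] <= n)%N by rewrite dvdn_leq ?(ltnW n_gt1) // order_dvdn an.
have le_ob : (#[b] <= 2)%N by rewrite dvdn_leq // order_dvdn b2.
have sRG : R \subset G by rewrite -defG' mulG_subl.
have Gb : b \in G by rewrite -cycle_subG -defG' mulG_subr.
have le_G : (n.*2 <= #[a] * #[b])%N.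
  by rewrite -oG -defG' /order (mul_cardG R <[b]>) leq_pmulr // cardG_gt0.
have oa : #[a] = n by nia.
have oT : #|G :\: R| = n by rewrite cardsD (setIidPr sRG) oG -orderE oa; lia.
have nRb' : b \notin R.
  apply: contraL n_gt1 => Rb; have : #|G| = n.
    by rewrite -defG' mulGSid ?cycle_subG.
  by rewrite oG; lia.
have T_E t : t \in G :\: R -> exists2 x, x \in R & t = x * b.
  have -> : G :\: R = R :* b.
    apply/esym/eqP; rewrite eqEcard card_rcoset oT -orderE oa leqnn andbT.
    apply/subsetP=> u /rcosetP[x Rx ->]; rewrite !inE.
    by rewrite groupMl // nRb' groupM // (subsetP sRG).
  by case/rcosetP=> x Rx ->; exists x.
have conjb x : x \in R -> x ^ b = x^-1.
  by case/cycleP=> i ->; rewrite conjXg ab expgVn.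
have bM x : x \in R -> b * x = x^-1 * b.
  by move=> Rx; rewrite -conjb // conjgE bV -!mulgA -expg2 b2 mulg1.
have abR x y : x \in R -> y \in R -> x * y = y * x.
  by move=> Rx Ry; apply: (centsP (cycle_abelian a)).
exists R; split=> //; first exact: cycle_cyclic.
split=> [t u /T_E[x Rx ->] /T_E[y Ry ->] | t /T_E[x Rx ->] | t x /T_E[y Ry ->] Rx].
- by rewrite mulgA -(mulgA x) bM // -!mulgA -expg2 b2 mulg1 groupM ?groupV.
- by rewrite mulgA -(mulgA x) bM // -!mulgA -expg2 b2 mulg1 mulgV.
- by rewrite conjgM (conjgE x y) (abR x y) // mulKg conjb.
Qed.

End DihedralStructure.

(** * The subgroup generating bipartite graph as a star forest *)

Section SubgroupGeneratingGraph.
Variables (gT : finGroupType) (G : {group gT}).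

Lemma gen_pair_subgroup (u : {u : gT * gT | u \in setX G G}) :
  <<[set (val u).1; (val u).2]>>%G \in subgroups G.
Proof.
by case: u => -[x y] /=; rewrite !inE gen_subG subUset !sub1set /= => /andP[-> ->].
Qed.

Definition generated_subgroup (u : {u : gT * gT | u \in setX G G}) :
    {H : {group gT} | H \in subgroups G} :=
  exist _ <<[set (val u).1; (val u).2]>>%G (gen_pair_subgroup u).

Lemma sgb_adjE (u v : sgb_vertex G) :
  sgb_adj u v = match u, v with
  | inl x, inr H | inr H, inl x => generated_subgroup x == H
  | _, _ => false end.
Proof.
by case: u v => [x|H] [y|K] //=; rewrite -val_eqE eq_sym.
Qed.

Lemma card_fiber_generated_subgroup (H : {H : {group gT} | H \in subgroups G}) :
  fiber_card generated_subgroup H = #|generating_pairs (val H)|.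
Proof.
rewrite /fiber_card -(card_imset _ val_inj); apply: eq_card => u.
rewrite inE; apply/imsetP/eqP => [[v] | defH].
  by rewrite inE => /eqP <- ->.
have Gu : u \in setX G G.
  have := valP H; rewrite inE -defH gen_subG subUset !sub1set => uG.
  by case: u uG {defH} => x y; rewrite inE.
exists (exist _ u Gu) => //.
by rewrite inE -val_eqE; apply/eqP/val_inj.
Qed.

Lemma sum_sgb_subgroups (V : nmodType) (F : nat -> V) :
  \sum_H F (fiber_card generated_subgroup H)
  = \sum_(H : {group gT} | H \subset G) F #|generating_pairs H|.
Proof.
transitivity (\sum_(H in subgroups G) F #|generating_pairs H|).
  rewrite [RHS]big_sub.
  by apply: eq_bigr => H _; rewrite card_fiber_generated_subgroup.
by apply: eq_bigl => H; rewrite inE.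
Qed.

Lemma card_sgb_pairs : #|{: {u : gT * gT | u \in setX G G}}| = (#|G| * #|G|)%N.
Proof. by rewrite card_sig -cardsX; apply: eq_card. Qed.

Lemma energy_sgb (C : numClosedFieldType) :
  energy C (sgb_graph G)
  = \sum_(H : {group gT} | H \subset G) 2 * sqrtC #|generating_pairs H|%:R.
Proof.
by rewrite (energy_star _ _ sgb_adjE) -(sum_sgb_subgroups (fun d => 2 * sqrtC d%:R)).
Qed.

Lemma card_sgb_subgroups :
  #|{: {H : {group gT} | H \in subgroups G}}|
  = (\sum_(H : {group gT} | H \subset G) 1)%N.
Proof. by rewrite -(sum_sgb_subgroups (fun=> 1%N)) sum1_card. Qed.

End SubgroupGeneratingGraph.

(** * The dihedral group of order 2 p^2 *)

Section DihedralPrimeSquare.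
Variables (p : nat) (gT : finGroupType) (G : {group gT}).
Hypotheses (p_pr : prime p) (dihG : is_dihedral (p ^ 2) G).

Lemma sum_subgroups_dihedral_prime_square (V : nmodType) (F : nat -> V) :
  \sum_(H : {group gT} | H \subset G) F #|generating_pairs H|
  = F 1%N + F (p ^ 2 - 1)%N + F (p ^ 4 - p ^ 2)%N
    + F 3%N *+ p ^ 2 + F (3 * (p * (p - 1)))%N *+ p
    + F (3 * (p ^ 3 * (p - 1)))%N.
Proof.
have p_gt0 := prime_gt0 p_pr; have p_gt1 := prime_gt1 p_pr.
have n_gt1 : (1 < p ^ 2)%N by rewrite -(exp1n 2) ltn_exp2r.
have [R [sRG cycR oR oT [mulT invT conjT]]] := dihedral_structure n_gt1 dihG.
rewrite -oR in oT.
rewrite (sum_subgroups_dihedral sRG cycR mulT invT conjT oT).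
(* [J k] is the number of generating pairs of a cyclic group whose order [k]
   is a power of [p]; as a function of the order alone it lets the sum over
   subgroups of [R] run over exponents. *)
pose J k := (if k == 1 then 1 else k * k - (k %/ p) * (k %/ p))%N.
pose phi k := F (J k) + F (3 * (k * totient k))%N *+ (p ^ 2 %/ k).
rewrite (eq_bigr (fun K : {group gT} => phi #|K|)) => [|K sKR]; last first.
  rewrite /phi oR; congr (F _ + _).
  have /(dvdn_pfactor _ _ p_pr)[[|i] _ oK] : (#|K| %| p ^ 2)%N by rewrite -oR cardSg.
    have /eqP/val_inj -> : K :==: 1%g by rewrite trivg_card1 oK.
    by rewrite card_generating_pairs1 cards1.
  rewrite (card_generating_pairs_cyclic_pgroup p_pr (cyclicS sKR cycR) oK).
  rewrite /J oK expnS mulKn // -expnS.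
  by rewrite -{1}(expn0 p) eqn_exp2l.
rewrite (sum_subgroups_cyclic_pgroup phi p_pr cycR oR).
have p_neq1 : (p == 1%N) = false by rewrite gtn_eqF.
have n_neq1 : (p ^ 2 == 1)%N = false by rewrite gtn_eqF.
have phi0 : phi 1%N = F 1%N + F 3%N *+ p ^ 2 by rewrite /phi /J /= divn1.
have phi1 : phi p = F (p ^ 2 - 1)%N + F (3 * (p * (p - 1)))%N *+ p.
  rewrite /phi /J p_neq1 divnn p_gt0 totient_prime // mulnn muln1 !subn1.
  by rewrite -[(p ^ 2 %/ p)%N]/(p * p %/ p)%N mulKn.
have phi2 : phi (p ^ 2)%N
    = F (p ^ 4 - p ^ 2)%N + F (3 * (p ^ 3 * (p - 1)))%N.
  rewrite /phi /J n_neq1 divnn expn_gt0 p_gt0 mulr1n totient_pfactor //=.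
  rewrite -expnD -[(p ^ 2 %/ p)%N]/(p * p %/ p)%N mulKn // -subn1.
  by congr (F _ + F _); rewrite ?subn1 /=; ring.
rewrite !big_ord_recl big_ord0 /= /bump /= expn0 expn1 phi0 phi1 phi2 addr0.
rewrite -!addrA; congr (_ + _); rewrite addrCA; congr (_ + _).
by rewrite [RHS]addrCA; congr (_ + _); rewrite addrCA.
Qed.

Lemma card_dihedral_prime_square : #|G| = (2 * p ^ 2)%N.
Proof.
have n_gt1 : (1 < p ^ 2)%N by rewrite -(exp1n 2) ltn_exp2r ?prime_gt1.
have [R [sRG _ oR oT _]] := dihedral_structure n_gt1 dihG.
by rewrite -(cardsID R G) (setIidPr sRG) oR oT mul2n addnn.
Qed.

End DihedralPrimeSquare.

Theorem theorem3p4 (C : numClosedFieldType) (p : nat) (p_prime : prime p)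
    (gT : finGroupType) (G : {group gT}) (dihG : is_dihedral (p ^ 2) G) :
  let q : C := p%:R in
  let B := sgb_graph G in
  [/\ energy C B = 2 + 2 * q ^+ 2 * sqrtC 3
                   + (2 * q + 2) * sqrtC (q ^+ 2 - 1)
                   + 4 * q * sqrtC (3 * q * (q - 1)),
      laplacian_energy C B =
        (32 * q ^+ 8 + 2 * q ^+ 4 + 4 * q ^+ 3 + 18 * q ^+ 2 + 16 * q + 32)
          / (4 * q ^+ 4 + q ^+ 2 + q + 4),
      (32 * q ^+ 8 + 2 * q ^+ 4 + 4 * q ^+ 3 + 18 * q ^+ 2 + 16 * q + 32)
          / (4 * q ^+ 4 + q ^+ 2 + q + 4) = signless_laplacian_energy C B
    & cn_energy C B = 8 * q ^+ 4 - 2 * q ^+ 2 - 2 * q - 8].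
Proof.
move=> q B; have p_gt0 := prime_gt0 p_prime; have p_gt1 := prime_gt1 p_prime.
have oX : #|{: {u : gT * gT | u \in setX G G}}| = (4 * p ^ 4)%N.
  by rewrite card_sgb_pairs (card_dihedral_prime_square p_prime dihG); ring.
have oL : #|{: {H : {group gT} | H \in subgroups G}}| = (p ^ 2 + p + 4)%N.
  rewrite card_sgb_subgroups.
  rewrite (sum_subgroups_dihedral_prime_square p_prime dihG (fun=> 1%N)).
  have nat1M k : 1%N *+ k = k by elim: k => // k IHk; rewrite mulrS IHk.
  by rewrite !nat1M; lia.
have fiber_gt0 (H : {H : {group gT} | H \in subgroups G}) :
    (0 < fiber_card (@generated_subgroup gT G) H)%N.
  have n_gt1 : (1 < p ^ 2)%N by rewrite -(exp1n 2) ltn_exp2r.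
  have [R [_ cycR _ _ [mulT invT conjT]]] := dihedral_structure n_gt1 dihG.
  rewrite card_fiber_generated_subgroup.
  apply: (card_generating_pairs_gt0 cycR mulT invT conjT).
  by have := valP H; rewrite inE.
have qX : (4 * p ^ 4)%:R = 4 * q ^+ 4 :> C by rewrite natrM natrX.
have qL : (p ^ 2 + p + 4)%:R = q ^+ 2 + q + 4 :> C by rewrite !natrD natrX.
have X_gt0 : (0 < #|{: {u : gT * gT | u \in setX G G}}|)%N.
  by rewrite oX muln_gt0 expn_gt0 p_gt0.
have LE : 2 * ((4 * p ^ 4)%:R ^+ 2 + (p ^ 2 + p + 4)%:R ^+ 2)
    / ((4 * p ^ 4)%:R + (p ^ 2 + p + 4)%:R)
  = (32 * q ^+ 8 + 2 * q ^+ 4 + 4 * q ^+ 3 + 18 * q ^+ 2 + 16 * q + 32)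
          / (4 * q ^+ 4 + q ^+ 2 + q + 4).
  by rewrite qX qL; congr (_ / _); ring.
split.
- rewrite energy_sgb.
  rewrite (sum_subgroups_dihedral_prime_square p_prime dihG (fun d => 2 * sqrtC d%:R)).
  have q_ge0 : 0 <= q by rewrite ler0n.
  have sqrt_q2M z : sqrtC (q ^+ 2 * z) = q * sqrtC z.
    by rewrite rootCMl ?exprn_ge0 // sqrCK.
  have -> : (p ^ 4 - p ^ 2)%:R = q ^+ 2 * (q ^+ 2 - 1).
    by rewrite natrB ?leq_pexp2l // !natrX -/q; ring.
  have -> : (3 * (p ^ 3 * (p - 1)))%:R = q ^+ 2 * (3 * q * (q - 1)).
    by rewrite !natrM natrB // ?natrX -/q; ring.
  have -> : (3 * (p * (p - 1)))%:R = 3 * q * (q - 1).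
    by rewrite !natrM natrB // -/q; ring.
  have -> : (p ^ 2 - 1)%:R = q ^+ 2 - 1 by rewrite natrB ?expn_gt0 ?p_gt0 // natrX.
  rewrite !sqrt_q2M sqrtC1 -[_ *+ p ^ 2]mulr_natr -[_ *+ p]mulr_natr natrX -/q; ring.
- rewrite (laplacian_energy_star _ _ (@sgb_adjE gT G)) // oX oL; exact: LE.
- rewrite (signless_laplacian_energy_star _ _ (@sgb_adjE gT G)) // oX oL -LE //.
- rewrite (cn_energy_star _ _ (@sgb_adjE gT G)) // oX oL qX qL; ring.
Qed.
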